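(* For every integer $n\ge 1$, \[ f(n,7,4)= \begin{cases} \left\lfloor\dfrac{30n}{7}\right\rfloor-1, & n\equiv 4\pmod 7\text{ and }n\ge 11,\\[2mm] \left\lfloor\dfrac{30n}{7}\right\rfloor, & \text{otherwise}. \end{cases} \] Moreover, $f(n,7,4)=\delta(n,7,3)$ for every integer $n\ge 1$.
   Context: All graphs are finite and simple. A balanced $r$-partite graph with parts of size $n$ is a graph $G$ whose vertex set is partitioned into $r$ sets $V_1,\dots,V_r$, each of size exactly $n$, with no edge of $G$ having both endpoints in the same $V_i$. For a graph $G$, $\delta(G)$ denotes its minimum degree and $\chi(G)$ its chromatic number; $K_{t+1}$ is the complete graph on $t+1$ vertices. For integers $n\ge 1$ and $2\le t\le r-1$ define \[ f(n,r,t+1):=\max\{\delta(G): G\text{ is balanced } r\text{-partite with parts of size } n\text{ and } G \text{ contains no copy of } K_{t+1}\}, \] \[ \delta(n,r,t):=\max\{\delta(G): G\text{ is balanced } r\text{-partite with parts of size } n\text{ and } \chi(G)\le t\}. \] In particular $f(n,7,4)$ concerns $K_4$-free balanced $7$-partite graphs, and $\delta(n,7,3)$ concerns $3$-colourable balanced $7$-partite graphs. *)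

(* Defs.v *)
From HB Require Import structures.
From mathcomp Require Import all_boot boolp.

Set Implicit Arguments.
Unset Strict Implicit.
Unset Printing Implicit Defensive.

Record sgraph := SGraph {
  vertex :> finType;
  adj : rel vertex;
  adj_sym : symmetric adj;
  adj_irrefl : irreflexive adj }.

Definition degree (G : sgraph) (x : G) : nat := #|[set y | adj x y]|.

(* Every degree is smaller than #|G|, so for nonempty G the neutral value #|G|
   is irrelevant and this is the true minimum. *)
Definition min_degree (G : sgraph) : nat :=
  \big[minn/#|G|]_(x : G) degree x.

Definition contains_K (s : nat) (G : sgraph) : Prop :=
  exists S : {set G}, #|S| = s /\ {in S &, forall x y, x != y -> adj x y}.

Definition colorable (G : sgraph) (k : nat) : bool :=
  [exists c : {ffun G -> 'I_k},
    [forall x, forall y, adj x y ==> (c x != c y)]].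

Lemma colorable_card (G : sgraph) : exists k, colorable G k.
Proof.
exists #|G|; apply/existsP; exists [ffun x => enum_rank x].
apply/forallP => x; apply/forallP => y; apply/implyP => exy.
rewrite !ffunE (inj_eq enum_rank_inj); apply: contraTneq exy => ->.
by rewrite adj_irrefl.
Qed.

Definition chromatic_number (G : sgraph) : nat := ex_minn (colorable_card G).

(* The parts V_1, ..., V_r are the fibres of part. *)
Definition balanced_parts (n r : nat) (G : sgraph) (part : G -> 'I_r) : Prop :=
  (forall i : 'I_r, #|[set x | part x == i]| = n) /\
  (forall x y : G, adj x y -> part x != part y).

Definition balanced_multipartite (n r : nat) (G : sgraph) : Prop :=
  exists part : G -> 'I_r, balanced_parts n part.

(* Such a G has r * n vertices, so bounding the candidate values d by r * n
   loses nothing: see max_min_degree_ub and max_min_degree_attained. *)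
Definition max_min_degree (n r : nat) (P : sgraph -> Prop) : nat :=
  \max_(d < (r * n).+1 |
     `[< exists G : sgraph,
           [/\ balanced_multipartite n r G, P G & min_degree G = d] >]) d.

Definition f (n r s : nat) : nat :=
  max_min_degree n r (fun G => ~ contains_K s G).

Definition delta (n r t : nat) : nat :=
  max_min_degree n r (fun G => chromatic_number G <= t).

Lemma card_balanced n r (G : sgraph) :
  balanced_multipartite n r G -> #|G| = r * n.
Proof.
move=> [part [sz _]].
rewrite -sum1_card (partition_big part predT) //=.
rewrite (eq_bigr (fun=> n)); first by rewrite sum_nat_const card_ord.
by move=> i _; rewrite sum1_card -(sz i) cardsE.
Qed.

Lemma min_degree_le_card (G : sgraph) : min_degree G <= #|G|.
Proof.
rewrite /min_degree; elim/big_ind: _ => //.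
- by move=> x y hx hy; rewrite geq_min hx.
- by move=> x _; apply: max_card.
Qed.

Lemma max_min_degree_ub n r (P : sgraph -> Prop) (G : sgraph) :
  balanced_multipartite n r G -> P G -> min_degree G <= max_min_degree n r P.
Proof.
move=> bG PG.
have h : min_degree G < (r * n).+1.
  by rewrite ltnS -(card_balanced bG) min_degree_le_card.
by apply: (leq_bigmax_cond (Ordinal h)); apply/asboolP; exists G.
Qed.

Lemma max_min_degree_attained n r (P : sgraph -> Prop) :
  (exists G, balanced_multipartite n r G /\ P G) ->
  exists G, [/\ balanced_multipartite n r G, P G &
                min_degree G = max_min_degree n r P].
Proof.
move=> [G0 [bG PG]].
have h : min_degree G0 < (r * n).+1.
  by rewrite ltnS -(card_balanced bG) min_degree_le_card.
rewrite /max_min_degree (bigmax_eq_arg (Ordinal h)); last first.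
  by apply/asboolP; exists G0.
case: arg_maxnP => [|d /asboolP[G HG] _]; first by apply/asboolP; exists G0.
by exists G.
Qed.

(* Main.v *)
Require Import Defs.
From mathcomp Require Import all_boot zify.
From mathcomp Require boolp.

(** Write #|X v| for the number of non-neighbours of [v] (with [v] itself),
    so that #|X v| <= n + D where D = 6n - delta, and 30n/7 corresponds to
    D = 12n/7.

    Upper bound. A K_4-free graph in which every vertex has fewer than 2/5 of
    all vertices as non-neighbours contains an independent set Q whose
    complement spans no triangle [triangle_free_off_exists]. On the other hand
    an independent set A that meets a part V_i has at most D vertices outside
    V_i, since a vertex of A in V_i misses A and V_i [independent_slice];
    hence 2|A| <= 3D as soon as A meets three parts [independent_card].

    These two facts collide. If Q meets a part V_i without containing it, a
    vertex x in V_i outside Q has at most D neighbours in Q, hence at least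
    6n - 2D neighbours outside Q, and those form an independent set. So
    6n - 2D <= 3D/2, which is D >= 12n/7 [nonfull_absurd]. If Q is a union of
    parts, it consists of at most two, and the disjoint neighbourhoods outside
    Q of two adjacent vertices are independent sets too large to fit into the
    remaining parts [union_of_parts_absurd].

    The exceptional residue. For n = 7q+4 and D = 12q+7 the inequality
    6n - 2D <= 3D/2 holds with 1/2 to spare, which forces
    A = N(x) minus Q to have 18q+10 vertices, split 6q+3, 6q+3, 6q+4 over
    three parts [tight_shape]. This rigidity makes the complement of Q and A
    independent [tight_bipartite], so the graph is 3-coloured by Q, A and the
    rest; looking at the part in which A has 6q+4 vertices shows that two of
    the colour classes are of this rigid kind and that the third one is too
    large [tight_three_colours_absurd]. The condition q >= 1 enters because for
    q = 0 the slice of size 6q+4 is a whole part.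

    Lower bound. The extremal graphs are 3-coloured: two colours each take
    about 6/7 of three parts, and the third one takes the seventh part and
    what is left of the other six [degree_construction]. Since 3-colourable
    graphs are K_4-free, delta(n,7,3) <= f(n,7,4), and both values are
    pinned down together. *)

Set Implicit Arguments.
Unset Strict Implicit.
Unset Printing Implicit Defensive.

(** * An independent set meeting every triangle of a dense K_4-free graph *)

Section Relations.
Variable T : finType.
Implicit Types (e : rel T) (A B Q : {set T}) (x y z w : T).

Definition independent e A := [forall x in A, forall y in A, ~~ e x y].

Definition K4_free e := forall x y z w,
  e x y -> e x z -> e x w -> e y z -> e y w -> e z w -> False.

Definition triangle_free_off e Q := forall x y z,
  x \notin Q -> y \notin Q -> z \notin Q -> e x y -> e x z -> e y z -> False.

Definition nbrs e x := [set y | e x y].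
Definition non_nbrs e x := [set y | ~~ e x y].

(** Among K_4-free graphs this is maximality under adding edges: the new edge
    [x y] would complete the edge [p q] to a K_4. *)
Definition edge_maximal e := forall x y, x != y -> ~~ e x y ->
  exists p q, [/\ e p q, e x p, e x q, e y p & e y q].

Definition add_edge e a b : rel T :=
  fun x y => [|| e x y, (x == a) && (y == b) | (x == b) && (y == a)].

Lemma independentP e A :
  reflect {in A &, forall x y, ~~ e x y} (independent e A).
Proof.
apply: (iffP forall_inP) => [h x y xA yA | h x xA].
  by move/forall_inP: (h x xA) => /(_ y yA).
by apply/forall_inP => y yA; apply: h.
Qed.

Lemma card_nbrs e x : #|nbrs e x| + #|non_nbrs e x| = #|T|.
Proof.
rewrite -(cardsC (nbrs e x)); congr (_ + _).
by apply: eq_card => y; rewrite !inE.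
Qed.

Lemma add_edge_sym e a b : symmetric e -> symmetric (add_edge e a b).
Proof.
move=> se x y; rewrite /add_edge se; congr (_ || _).
by rewrite orbC andbC [(y == b) && _]andbC.
Qed.

Lemma add_edge_irr e a b :
  irreflexive e -> a != b -> irreflexive (add_edge e a b).
Proof.
move=> ie nab x; rewrite /add_edge ie /=.
by apply/negP => /orP[] /andP[/eqP-> /eqP h]; move: nab; rewrite h eqxx.
Qed.

(** A K_4 of the enlarged graph would have to use the new edge [a b], and its
    other two vertices would form an edge seen by both [a] and [b]. *)
Lemma K4_free_add_edge e a b :
  symmetric e -> irreflexive e -> K4_free e -> a != b ->
  (forall p q, e p q -> e a p -> e a q -> e b p -> e b q -> False) ->
  K4_free (add_edge e a b).
Proof.
move=> se ie K nab nopq; set e' := add_edge e a b.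
have se' : symmetric e' by apply: add_edge_sym.
have ie' : irreflexive e' by apply: add_edge_irr.
have old x y : e' x y -> x != a -> x != b -> e x y.
  by rewrite /e' /add_edge => /or3P[|/andP[/eqP->]|/andP[/eqP->]] //;
    rewrite eqxx.
have neq x y : e' x y -> y != x.
  by apply: contraTneq => ->; rewrite ie'.
have clique z w : e' a z -> e' a w -> e' b z -> e' b w -> e' z w -> False.
  move=> az aw bz bw zw.
  have [za zb] := (neq _ _ az, neq _ _ bz).
  have [wa wb] := (neq _ _ aw, neq _ _ bw).
  move: az aw bz bw; rewrite ![e' a _]se' ![e' b _]se' => az aw bz bw.
  by apply: (nopq z w); [|rewrite se|rewrite se|rewrite se|rewrite se];
    apply: old.
have new x y : e' x y -> e x y \/ (x = a /\ y = b) \/ (x = b /\ y = a).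
  by case/or3P=> [|/andP[/eqP-> /eqP->]|/andP[/eqP-> /eqP->]];
    [left|right; left|right; right].
have pair x y z w : e' x y -> e' x z -> e' x w -> e' y z -> e' y w -> e' z w ->
    e x y.
  move=> xy xz xw yz yw zw; case: (new _ _ xy) => [//|[] [xE yE]];
    by rewrite xE yE in xz xw yz yw; case: (clique z w).
move=> x y z w xy xz xw yz yw zw.
have s u v : e' u v -> e' v u by rewrite se'.
by apply: (K x y z w); [apply: (pair x y z w)|apply: (pair x z y w)
  |apply: (pair x w y z)|apply: (pair y z x w)|apply: (pair y w x z)
  |apply: (pair z w x y)]; auto.
Qed.

(** Let Q be a maximum independent set; it turns out that a vertex of Q is
    adjacent to everything outside Q, so that a triangle outside Q would give
    a K_4. The reason is a gap between two kinds of pairs.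
    Adjacent [x], [y] have an independent common neighbourhood, of size at most
    |Q|, so their non-neighbourhoods share at most |Q| + 2m - |T| vertices.
    Non-adjacent [x], [y] see a common edge [p q]; the vertices joined to both
    [p] and [q], at least |T| - 2m of them, are missed by [x] and by [y].
    If [q] in Q missed a vertex [c] outside Q, then [c] would be adjacent to
    some [q'] in Q, hence miss few vertices of Q by the first bound, but many
    by the second one; the two bounds clash when 5m < 2|T|. *)
Lemma triangle_free_off_edge_maximal e m :
  symmetric e -> irreflexive e -> K4_free e -> edge_maximal e ->
  (forall x, #|non_nbrs e x| <= m) -> 5 * m < 2 * #|T| ->
  exists2 Q, independent e Q & triangle_free_off e Q.
Proof.
move=> se ie K sat Xm mT.
have i0 : independent e set0 by apply/independentP => x y; rewrite inE.
case: (arg_maxnP (fun A => #|A|) i0) => Q iQ Qmax.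
exists Q => //.
have lowN p q : #|T| <= #|nbrs e p :&: nbrs e q| + 2 * m.
  have := cardsUI (nbrs e p) (nbrs e q).
  have : #|nbrs e p :|: nbrs e q| <= #|T| by apply: max_card.
  have := card_nbrs e p; have := card_nbrs e q; have := Xm p; have := Xm q.
  lia.
have adjX x y : e x y ->
    #|non_nbrs e x :&: non_nbrs e y| + #|T| <= #|Q| + 2 * m.
  move=> xy.
  have iN : independent e (nbrs e x :&: nbrs e y).
    apply/independentP => z w; rewrite !inE => /andP[xz yz] /andP[xw yw].
    by apply/negP => zw; apply: (K x y z w).
  have := Qmax _ iN.
  have -> : nbrs e x :&: nbrs e y = ~: (non_nbrs e x :|: non_nbrs e y).
    by apply/setP => z; rewrite !inE negb_or !negbK.
  have := cardsC (non_nbrs e x :|: non_nbrs e y).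
  have := cardsUI (non_nbrs e x) (non_nbrs e y).
  have := Xm x; have := Xm y; rewrite /=; lia.
have nonadjX x y : x != y -> ~~ e x y ->
    #|T| <= #|non_nbrs e x :&: non_nbrs e y| + 2 * m.
  move=> nxy exy; have [p [q [pq xp xq yp yq]]] := sat x y nxy exy.
  apply: leq_trans (lowN p q) _; rewrite leq_add2r subset_leq_card //.
  apply/subsetP => z; rewrite !inE => /andP[pz qz].
  by apply/andP; split; apply/negP => h;
    [apply: (K x p q z) | apply: (K y p q z)].
have XQ q : q \in Q -> non_nbrs e q \subset Q.
  move=> qQ; apply/subsetP => c cX; apply/negPn/negP => cQ.
  have [q' q'Q cq'] : exists2 q', q' \in Q & e c q'.
    apply/exists_inP; apply: contraT; rewrite negb_exists_in => /forall_inP h.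
    have : independent e (c |: Q).
      apply/independentP => x y; rewrite !inE.
      move=> /orP[/eqP->|xQ] /orP[/eqP->|yQ]; rewrite ?ie //; first exact: h.
        by rewrite se; apply: h.
      by apply: (independentP e Q iQ).
    by move/Qmax; rewrite /= cardsU1 cQ add1n ltnn.
  have sQX x : x \in Q -> Q \subset non_nbrs e x.
    by move=> xQ; apply/subsetP => y yQ; rewrite inE (independentP e Q iQ).
  have h1 := adjX _ _ cq'.
  have cNq : c != q by apply: contraNneq cQ => ->.
  have h2 : #|T| <= #|non_nbrs e c :&: non_nbrs e q| + 2 * m.
    by apply: nonadjX => //; rewrite se; move: cX; rewrite inE.
  have h3 : #|non_nbrs e c :&: non_nbrs e q|
      <= #|non_nbrs e c :&: non_nbrs e q'| + #|non_nbrs e q :\: Q|.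
    apply: leq_trans (leq_card_setU _ _); apply: subset_leq_card.
    apply/subsetP => z; rewrite [z \in _ :&: _]inE => /andP[zc zq].
    rewrite !(in_setU, in_setI, in_setD) zc zq andbT /=.
    by case: (boolP (z \in Q)) => [/(subsetP (sQX _ q'Q))->|]; rewrite ?orbT.
  have := cardsID Q (non_nbrs e q); rewrite (setIidPr (sQX _ qQ)).
  have := Xm q; lia.
have nbrQ q x : q \in Q -> x \notin Q -> e q x.
  by move=> qQ; apply: contraR => qx; apply: (subsetP (XQ q qQ)); rewrite inE.
move=> x y z xQ yQ zQ xy xz yz.
have /set0Pn[q qQ] : Q != set0.
  have : independent e [set x].
    by apply/independentP => u v /set1P-> /set1P->; rewrite ie.
  by move/Qmax; rewrite /= cards1 -card_gt0.
by apply: (K q x y z) => //; apply: nbrQ.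
Qed.

(** Adding edges preserves the degree condition, and a set that works for the
    larger graph works for the smaller one. *)
Lemma triangle_free_off_exists e m :
  symmetric e -> irreflexive e -> K4_free e ->
  (forall x, #|non_nbrs e x| <= m) -> 5 * m < 2 * #|T| ->
  exists2 Q, independent e Q & triangle_free_off e Q.
Proof.
move=> + + + + mT.
have [k] := ubnP #|[set u : T * T | ~~ e u.1 u.2]|.
elim: k e => // k IHk e lek se ie K Xm.
case: (boolP [exists u : T * T, [&& u.1 != u.2, ~~ e u.1 u.2 &
   ~~ [exists v : T * T, [&& e v.1 v.2, e u.1 v.1, e u.1 v.2, e u.2 v.1
     & e u.2 v.2]]]]) => [/existsP[[a b] /= /and3P[nab eab nopq]]|sat].
  have sub x y : e x y -> add_edge e a b x y by rewrite /add_edge => ->.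
  have [||||x|Q iQ tQ] := IHk (add_edge e a b).
  - rewrite ltnS in lek; apply: leq_trans lek; apply: proper_card.
    apply/properP; split.
      by apply/subsetP => u; rewrite !inE; apply: contra; apply: sub.
    by exists (a, b); rewrite !inE //= /add_edge !eqxx orbT.
  - exact: add_edge_sym.
  - exact: add_edge_irr.
  - apply: K4_free_add_edge => // p q pq ap aq bp bq.
    by move/existsP: nopq; apply; exists (p, q); rewrite /= pq ap aq bp.
  - apply: leq_trans (Xm x); apply: subset_leq_card.
    by apply/subsetP => y; rewrite !inE; apply: contra; apply: sub.
  exists Q => [|x y z xQ yQ zQ xy xz yz]; last first.
    by apply: (tQ x y z) => //; apply: sub.
  apply/independentP => x y xQ yQ.
  by apply: contra (independentP _ _ iQ x y xQ yQ); apply: sub.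
apply: (@triangle_free_off_edge_maximal e m) => // x y nxy exy.
move: sat; rewrite negb_exists => /forallP/(_ (x, y)) /=.
rewrite nxy exy /= negbK => /existsP[[p q] /= /and5P[*]].
by exists p, q.
Qed.

End Relations.

(** * Independent sets in a balanced 7-partite graph *)

Section Parts.
Variables (T : finType) (e : rel T) (n D : nat) (part : T -> 'I_7).
Hypotheses (e_sym : symmetric e).
Hypothesis card_part : forall i, #|[set x | part x == i]| = n.
Hypothesis part_adj : forall x y, e x y -> part x != part y.
Hypothesis card_non_nbrs : forall x, #|non_nbrs e x| <= n + D.
Implicit Types (A B Q Y Z : {set T}) (x y z w : T) (i j k l : 'I_7).

Local Notation V i := [set x | part x == i].

Definition slice A i := A :&: V i.
Definition support A := part @: A.

Lemma mem_support A i : (i \in support A) = (0 < #|slice A i|).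
Proof.
apply/imsetP/card_gt0P => [[x xA ->]|[x]].
  by exists x; rewrite !inE xA /=.
by rewrite !inE => /andP[xA /eqP <-]; exists x.
Qed.

Lemma card_slice_le A i : #|slice A i| <= n.
Proof. by rewrite -(card_part i) subset_leq_card // subsetIr. Qed.

Lemma card_sum_slices A : #|A| = \sum_i #|slice A i|.
Proof.
rewrite -sum1_card (partition_big part predT) //=; apply: eq_bigr => i _.
by rewrite sum1_card; apply: eq_card => x; rewrite !inE.
Qed.

Lemma card_le_support A : #|A| <= n * #|support A|.
Proof.
rewrite card_sum_slices (bigID (mem (support A))) /= [X in _ + X]big1 ?addn0.
  rewrite mulnC -sum_nat_const; apply: leq_sum => i _; exact: card_slice_le.
by move=> i; rewrite mem_support -eqn0Ngt => /eqP.
Qed.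

Lemma card_slices3_le A i j k : i != j -> j != k -> k != i ->
  #|slice A i| + #|slice A j| + #|slice A k| <= #|A|.
Proof.
move=> nij njk nki; rewrite (card_sum_slices A) (bigD1 i) //=.
rewrite (bigD1 j) 1?eq_sym //= (bigD1 k) /=; last by rewrite nki eq_sym.
by rewrite !addnA leq_addr.
Qed.

Lemma card_slices4_le A i j k l : i != j -> j != k -> k != i ->
    l != i -> l != j -> l != k ->
  #|slice A i| + #|slice A j| + #|slice A k| + #|slice A l| <= #|A|.
Proof.
move=> nij njk nki nli nlj nlk; rewrite (card_sum_slices A) (bigD1 i) //=.
rewrite (bigD1 j) 1?eq_sym //= (bigD1 k) /=; last by rewrite nki eq_sym.
by rewrite (bigD1 l) /= ?nli ?nlj // !addnA leq_addr.
Qed.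

Lemma card_slice_disjoint A B i :
  [disjoint A & B] -> #|slice A i| + #|slice B i| <= n.
Proof.
move=> dAB; rewrite -(card_part i) -cardsUI.
rewrite [slice A i :&: _](_ : _ = set0) ?cards0 ?addn0; last first.
  apply/setP => x; rewrite !inE; case: (boolP (x \in A)) => //= xA.
  by rewrite (disjointFr dAB xA) andbF.
by rewrite subset_leq_card // subUset !subsetIr.
Qed.

Lemma card_vertices : #|T| = 7 * n.
Proof.
rewrite -cardsT card_sum_slices (eq_bigr (fun=> n)) => [|i _].
  by rewrite sum_nat_const card_ord.
by rewrite -(card_part i); apply: eq_card => x; rewrite !inE.
Qed.

Lemma card_nbrs_ge x : 6 * n <= #|nbrs e x| + D.
Proof.
have := card_nbrs e x; have := card_non_nbrs x; rewrite card_vertices; lia.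
Qed.

(** [x] has no neighbour in its own part. *)
Lemma nbrs_slice A x : #|nbrs e x :&: A| + #|slice A (part x)| <= #|A|.
Proof.
rewrite -[X in _ <= X](cardsID (V (part x)) A) addnC leq_add2l.
apply: subset_leq_card; apply/subsetP => y; rewrite !inE => /andP[xy ->].
by rewrite eq_sym (part_adj xy).
Qed.

(** A vertex of [A] in part [i] is adjacent neither to [A] nor to its part. *)
Lemma independent_slice A i :
  independent e A -> i \in support A -> #|A| <= #|slice A i| + D.
Proof.
move=> iA /imsetP[x xA ->].
have : A :|: V (part x) \subset non_nbrs e x.
  apply/subsetP => y; rewrite !inE => /orP[yA|/eqP pxy].
    exact: (independentP _ _ iA).
  by apply/negP => /part_adj; rewrite pxy eqxx.
move/subset_leq_card => h.
have := cardsUI A (V (part x)); rewrite card_part -/(slice A _).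
have := card_non_nbrs x; lia.
Qed.

(** Two parts have only 2n vertices. *)
Lemma support_gt2 A : 2 * n < #|A| ->
  exists i j k, [/\ i \in support A, j \in support A & k \in support A] /\
    [/\ i != j, j != k & k != i].
Proof.
move=> bigA; apply/card_gt2P; rewrite ltnNge; apply/negP => le2.
have := card_le_support A; nia.
Qed.

(** Add up the bound of [independent_slice] over three parts that [A] meets: the
    slices removed are disjoint, so 3|A| - |A| <= 3D. *)
Lemma independent_card A :
  independent e A -> 2 * n < #|A| -> 2 * #|A| <= 3 * D.
Proof.
move=> iA /support_gt2[i [j [k [[iS jS kS] [nij njk nki]]]]].
have := independent_slice iA iS; have := independent_slice iA jS.
have := independent_slice iA kS; have := card_slices3_le A nij njk nki; lia.
Qed.

Lemma independent_nbrsD Q x :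
  triangle_free_off e Q -> x \notin Q -> independent e (nbrs e x :\: Q).
Proof.
move=> tQ xQ; apply/independentP => y z.
rewrite !inE => /andP[yQ xy] /andP[zQ xz].
by apply/negP => yz; apply: (tQ x y z).
Qed.

Lemma disjoint_nbrsD Q x y :
  triangle_free_off e Q -> x \notin Q -> y \notin Q -> e x y ->
  [disjoint nbrs e x :\: Q & nbrs e y :\: Q].
Proof.
move=> tQ xQ yQ xy; apply/pred0P => z; rewrite !inE.
by apply/negP => /andP[/andP[zQ xz] /andP[_ yz]]; apply: (tQ x y z).
Qed.

(** [Q] has at most 2n vertices, so the neighbourhoods outside [Q] of two
    adjacent vertices are disjoint independent sets [A] and [B] of size above
    2n, and each meets at least three parts, none of them in [Q]. A part met by
    both is impossible by [independent_slice]; otherwise [Q] is at most one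
    part, which makes [A] exceed the bound of [independent_card]. *)
Lemma union_of_parts_absurd Q :
  independent e Q -> triangle_free_off e Q ->
  (forall i, i \in support Q -> V i \subset Q) ->
  4 * D < 7 * n -> False.
Proof.
move=> iQ tQ fullQ Dn.
have slQ i : i \in support Q -> #|slice Q i| = n.
  by move=> /fullQ sVQ; rewrite /slice (setIidPr sVQ) card_part.
have cardQ : #|Q| <= 2 * n.
  rewrite leqNgt; apply/negP => bigQ.
  have [i [j [k [[iS jS kS] [nij njk nki]]]]] := support_gt2 bigQ.
  have := independent_slice iQ iS; have := card_slices3_le Q nij njk nki.
  rewrite !slQ //; lia.
have nbrsW x : 6 * n <= #|nbrs e x :\: Q| + #|Q| + D.
  have := card_nbrs_ge x; have := cardsID Q (nbrs e x).
  have := subset_leq_card (subsetIr (nbrs e x) Q); lia.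
have /card_gt0P[w wQ] : 0 < #|~: Q|.
  have := cardsC Q; rewrite card_vertices; lia.
rewrite inE in wQ.
have /card_gt0P[w'] : 0 < #|nbrs e w :\: Q|.
  by have := nbrsW w; lia.
rewrite !inE => /andP[w'Q ww'].
have dAB := disjoint_nbrsD tQ wQ w'Q ww'.
have iA := independent_nbrsD tQ wQ; have iB := independent_nbrsD tQ w'Q.
have := nbrsW w; have := nbrsW w'.
set A := nbrs e w :\: Q in dAB iA *; set B := nbrs e w' :\: Q in dAB iB *.
move=> cB cA.
case: (boolP [disjoint support A & support B]) => [dS|]; last first.
  case/pred0Pn => j /andP[/= jA jB].
  have := independent_slice iA jA; have := independent_slice iB jB.
  have := card_slice_disjoint j dAB; clear - cardQ cA cB Dn; lia.
have dQ x : [disjoint support Q & support (nbrs e x :\: Q)].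
  apply/pred0P => i; apply/negP => /andP[/= /fullQ/subsetP sVQ].
  move=> /imsetP[y]; rewrite !inE => /andP[yQ _] iE.
  by move: yQ; rewrite sVQ // inE iE.
have bigA : 2 * n < #|A| by lia.
have bigB : 2 * n < #|B| by lia.
have sA : 2 < #|support A|.
  have [i [j [k h]]] := support_gt2 bigA.
  by apply/card_gt2P; exists i, j, k.
have sB : 2 < #|support B|.
  have [i [j [k h]]] := support_gt2 bigB.
  by apply/card_gt2P; exists i, j, k.
have s7 : #|support Q| + #|support A| + #|support B| <= 7.
  have : #|support Q :|: support A :|: support B| <= 7.
    by apply: leq_trans (max_card _) _; rewrite card_ord.
  have := cardsUI (support Q :|: support A) (support B).
  have := cardsUI (support Q) (support A).
  by rewrite setIUl !disjoint_setI0 ?setU0 ?cards0 ?dQ //; clear; lia.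
have := card_le_support Q; have := independent_card iA bigA.
have : n * #|support Q| <= n * 1 by rewrite leq_mul2l; lia.
lia.
Qed.

(** As [Q] has at most D vertices outside the part of [x], so many neighbours of
    [x] at most lie in [Q]. *)
Lemma card_nbrsD_ge Q x : independent e Q -> part x \in support Q ->
  6 * n <= #|nbrs e x :\: Q| + 2 * D.
Proof.
move=> iQ xS; have := card_nbrs_ge x; have := cardsID Q (nbrs e x).
have := nbrs_slice Q x; have := independent_slice iQ xS; lia.
Qed.

Lemma nonfull_absurd Q x :
  independent e Q -> triangle_free_off e Q -> part x \in support Q ->
  x \notin Q -> 7 * D < 12 * n -> False.
Proof.
move=> iQ tQ xS xQ Dn; have := card_nbrsD_ge iQ xS.
have := independent_card (independent_nbrsD tQ xQ); lia.
Qed.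

(** * The case n = 7q+4, D = 12q+7 *)

Section Tight.
Variable q : nat.
Hypotheses (q_gt0 : 0 < q) (nE : n = 7 * q + 4) (DE : D = 12 * q + 7).

Lemma tight_independent A : independent e A -> #|A| <= 18 * q + 10.
Proof. by move=> iA; have := independent_card iA; lia. Qed.

Lemma tight_slice A i : independent e A -> 18 * q + 10 <= #|A| ->
  i \in support A -> 6 * q + 3 <= #|slice A i|.
Proof. by move=> iA cA iS; have := independent_slice iA iS; lia. Qed.

(** Each nonempty slice has at least 6q+3 vertices, and three of them sum up to
    at most 18q+10, which leaves one surplus vertex and no room for a fourth. *)
Lemma tight_shape A : independent e A -> 18 * q + 10 <= #|A| ->
  exists i j k, [/\ i != j, j != k & k != i] /\
    [/\ #|slice A i| = 6 * q + 3, #|slice A j| = 6 * q + 3,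
        #|slice A k| = 6 * q + 4 &
        forall l, l != i -> l != j -> l != k -> #|slice A l| = 0].
Proof.
move=> iA cA; have leA := tight_independent iA.
have [|i [j [k [[iS jS kS] [nij njk nki]]]]] := @support_gt2 A.
  by lia.
have := card_slices3_le A nij njk nki.
have ci := tight_slice iA cA iS; have cj := tight_slice iA cA jS.
have ck := tight_slice iA cA kS => le3.
have other l : l != i -> l != j -> l != k -> #|slice A l| = 0.
  move=> nli nlj nlk; apply/eqP; rewrite eqn0Ngt -mem_support; apply/negP => lS.
  have := tight_slice iA cA lS.
  have := card_slices4_le A nij njk nki nli nlj nlk.
  by clear - leA ci cj ck; lia.
have sumA : #|A| = #|slice A i| + #|slice A j| + #|slice A k|.
  rewrite (card_sum_slices A) (bigD1 i) //= (bigD1 j) 1?eq_sym //=.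
  rewrite (bigD1 k) /=; last by rewrite nki eq_sym.
  rewrite big1 ?addn0 ?addnA // => l /andP[/andP[nli nlj] nlk].
  exact: other.
have [ei|ei] := eqVneq #|slice A i| (6 * q + 4).
  exists j, k, i; split; [by split | split; try by clear other; lia].
  by move=> l nlj nlk nli; apply: other.
have [ej|ej] := eqVneq #|slice A j| (6 * q + 4).
  exists k, i, j; split; [by split | split; try by clear other; lia].
  by move=> l nlk nli nlj; apply: other.
exists i, j, k; split; [by split | split; try by clear other; lia].
exact: other.
Qed.

(** The vertices of [A] and of part [i] are already n + D non-neighbours of
    [x], all that it can have. *)
Lemma tight_complete A i x y : independent e A -> 18 * q + 10 <= #|A| ->
  #|slice A i| = 6 * q + 3 -> x \in slice A i -> y \notin A -> part y != i ->
  e x y.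
Proof.
move=> iA cA ci; rewrite !inE => /andP[xA /eqP xi] yA yi; apply: contraT => xy.
have : y |: (A :|: V i) \subset non_nbrs e x.
  apply/subsetP => z; rewrite !inE => /or3P[/eqP->//|zA|/eqP zi].
    exact: (independentP _ _ iA).
  by apply/negP => /part_adj; rewrite xi zi eqxx.
move/subset_leq_card; rewrite cardsU1 !inE (negPf yA) (negPf yi) /=.
have := cardsUI A (V i); rewrite card_part -/(slice A i).
have := card_non_nbrs x; lia.
Qed.

(** By [tight_complete] an edge outside [Q] and [A] must run between the two
    parts [i] and [j] in which [A] has 6q+3 vertices. The disjoint
    neighbourhoods outside [Q] of its ends then lie in these two parts and the
    third slice of [A], which is too small for them. *)
Lemma tight_bipartite Q A : independent e Q -> independent e A ->
  triangle_free_off e Q -> [disjoint A & Q] -> 18 * q + 10 <= #|A| ->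
  independent e (~: (Q :|: A)).
Proof.
move=> iQ iA tQ dAQ cA; have leQ := tight_independent iQ.
have [i [j [k [[nij njk nki] [ci cj ck other]]]]] := tight_shape iA cA.
have AQ x : x \in A -> x \notin Q by move/(disjointFr dAQ)->.
(* An edge avoiding a part with 6q+3 vertices of A would close a triangle. *)
have meets l x y : #|slice A l| = 6 * q + 3 ->
    x \in ~: (Q :|: A) -> y \in ~: (Q :|: A) -> e x y ->
    (part x == l) || (part y == l).
  move=> cl; rewrite !inE !negb_or => /andP[xQ xA] /andP[yQ yA] xy.
  apply: contraT; rewrite negb_or => /andP[nxl nyl].
  have /card_gt0P[u ul] : 0 < #|slice A l| by rewrite cl addnS.
  have uQ : u \notin Q by move: ul; rewrite inE => /andP[/AQ].
  by case: (tQ u x y uQ xQ yQ) => //; apply: (tight_complete (A := A) (i := l)).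
have main x y : x \in ~: (Q :|: A) -> y \in ~: (Q :|: A) -> e x y ->
    part x = i -> part y = j -> False.
  move=> xB yB xy xi yj.
  have nbrs_in z w : z \in ~: (Q :|: A) -> part z = i \/ part z = j ->
      e z w -> w \notin Q -> w \in V i :|: V j :|: slice A k.
    move=> zB zij zw wQ; rewrite !inE.
    case: (boolP (w \in A)) => [wA|wA].
      case: (eqVneq (part w) i) => //= nwi.
      case: (eqVneq (part w) j) => //= nwj.
      apply: contraT => nwk.
      have : part w \in support A by apply: imset_f.
      by rewrite mem_support other.
    have wB : w \in ~: (Q :|: A) by rewrite !inE negb_or wQ wA.
    have := meets i z w ci zB wB zw; have := meets j z w cj zB wB zw.
    case: zij => -> /orP[/eqP h|->]; rewrite ?orbT //.
      by move: nij; rewrite h eqxx.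
    by case/orP=> [/eqP ji|->//]; move: nij; rewrite ji eqxx.
  have xQ : x \notin Q by move: xB; rewrite !inE negb_or => /andP[].
  have yQ : y \notin Q by move: yB; rewrite !inE negb_or => /andP[].
  have sub : (nbrs e x :\: Q) :|: (nbrs e y :\: Q)
      \subset V i :|: V j :|: slice A k.
    apply/subsetP => w; rewrite [in X in X -> _]inE => /orP[];
      rewrite [in X in X -> _]inE => /andP[wQ]; rewrite inE => zw.
      by apply: (nbrs_in x); auto.
    by apply: (nbrs_in y); auto.
  have := subset_leq_card sub.
  have := cardsUI (nbrs e x :\: Q) (nbrs e y :\: Q).
  rewrite (disjoint_setI0 (disjoint_nbrsD tQ xQ yQ xy)) cards0.
  have [+ _] := leq_card_setU (V i :|: V j) (slice A k).
  have [+ _] := leq_card_setU (V i) (V j); rewrite !card_part.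
  have := card_nbrs_ge x; have := card_nbrs_ge y.
  have := cardsID Q (nbrs e x); have := cardsID Q (nbrs e y).
  have := subset_leq_card (subsetIr (nbrs e x) Q).
  have := subset_leq_card (subsetIr (nbrs e y) Q).
  by clear - q_gt0 nE DE leQ ck; lia.
apply/independentP => x y xB yB; apply/negP => xy.
have := meets i x y ci xB yB xy; have := meets j x y cj xB yB xy.
case/orP=> /eqP h1 /orP[] /eqP h2.
- by move: nij; rewrite -h1 -h2 eqxx.
- by apply: (main y x) => //; rewrite e_sym.
- exact: (main x y).
- by move: nij; rewrite -h1 -h2 eqxx.
Qed.

(** The vertex [y] has at most D neighbours in [A], so at least 18q+10 in [Z].
    Thus [Z], like [A], has only slices of size at least 6q+3; part [i] has no
    room for one next to that of [A], and only q vertices are left there for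
    [Y]. But [Y] has at least 13q+8 vertices, which contradicts
    [independent_slice] at part [i]. *)
Lemma tight_three_colours_absurd A Y Z y i :
  independent e A -> independent e Y -> independent e Z ->
  [disjoint A & Y] -> [disjoint A & Z] -> A :|: Y :|: Z = setT ->
  18 * q + 10 <= #|A| ->
  #|slice A i| = 6 * q + 4 -> y \in Y -> part y = i -> False.
Proof.
move=> iA iY iZ dAY dAZ cov cA cAi yY yi.
have yS : i \in support Y by rewrite -yi imset_f.
have AS : i \in support A by rewrite mem_support; lia.
have cZ : 18 * q + 10 <= #|Z|.
  have : nbrs e y \subset (nbrs e y :&: A) :|: Z.
    apply/subsetP => z; rewrite !inE => yz; rewrite yz /=.
    have : z \in A :|: Y :|: Z by rewrite cov inE.
    rewrite !inE => /orP[/orP[->//|zY]|->]; last by rewrite orbT.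
    by move: (independentP _ _ iY y z yY zY); rewrite yz.
  move/subset_leq_card; have [+ _] := leq_card_setU (nbrs e y :&: A) Z.
  have := nbrs_slice A y; have := card_nbrs_ge y; rewrite yi.
  have := independent_slice iA AS; lia.
have Zi : #|slice Z i| = 0.
  apply/eqP; rewrite eqn0Ngt -mem_support; apply/negP => iS.
  have := tight_slice iZ cZ iS; have := card_slice_disjoint i dAZ; lia.
have leA := tight_independent iA; have leZ := tight_independent iZ.
have cY : 13 * q + 8 <= #|Y|.
  have [+ _] := leq_card_setU (A :|: Y) Z; have [+ _] := leq_card_setU A Y.
  rewrite cov cardsT card_vertices; lia.
have := independent_slice iY yS; have := card_slice_disjoint i dAY; lia.
Qed.

End Tight.

(** The first alternative says that the minimum degree 6n - D exceeds 30n/7, the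
    second one that it is the integer part of 30n/7 in the exceptional
    residue class. *)
Lemma K4_free_min_degree_absurd :
  irreflexive e -> K4_free e ->
  7 * D < 12 * n \/ (exists q, [/\ 0 < q, n = 7 * q + 4 & D = 12 * q + 7]) ->
  False.
Proof.
move=> ie K hD.
have [Q iQ tQ] : exists2 Q, independent e Q & triangle_free_off e Q.
  apply: (@triangle_free_off_exists _ e (n + D)) => //; rewrite card_vertices.
  by case: hD => [|[q []]]; lia.
case: (pickP [pred x | (x \notin Q) && (part x \in support Q)]); last first.
  move=> full; apply: (union_of_parts_absurd iQ tQ) => [i iS|].
    apply/subsetP => x; rewrite inE => /eqP xi; apply: contraT => xQ.
    by move: (full x); rewrite /= xQ xi iS.
  by case: hD => [|[q []]]; lia.
move=> x /= /andP[xQ xS].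
case: hD => [|[q [q0 nE DE]]]; first exact: (nonfull_absurd iQ tQ xS xQ).
have iA := independent_nbrsD tQ xQ; have := card_nbrsD_ge iQ xS.
set A := nbrs e x :\: Q in iA * => leA; set B := ~: (Q :|: A).
have cA : 18 * q + 10 <= #|A| by lia.
have dAQ : [disjoint A & Q] by rewrite -setI_eq0 /A setIDAC setDIl setDv setI0.
have iB : independent e B by apply: (tight_bipartite q0 nE DE).
have dAB : [disjoint A & B].
  by rewrite -setI_eq0 /B setCU setICA setICr setI0.
have [i [j [k [[nij njk nki] [ci cj ck other]]]]] := tight_shape q0 nE DE iA cA.
have /card_gt0P[y] : 0 < #|V k :\: A|.
  have := cardsID A (V k); rewrite setIC -/(slice A k) card_part.
  by clear - q0 nE ck; lia.
rewrite in_setD => /andP[yA]; rewrite inE => /eqP yk.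
have cov1 : A :|: Q :|: B = setT by rewrite [A :|: Q]setUC setUCr.
case: (boolP (y \in Q)) => yQ.
  by apply: (tight_three_colours_absurd q0 nE DE iA iQ iB) ck yQ yk.
have yB : y \in B by rewrite in_setC in_setU negb_or yQ yA.
apply: (tight_three_colours_absurd q0 nE DE iA iB iQ _ _ _ _ ck yB yk) => //.
by rewrite setUAC.
Qed.

End Parts.

(** * Minimum degree, cliques and colourings *)

Lemma min_degree_le (G : sgraph) (x : G) : min_degree G <= degree x.
Proof.
rewrite /min_degree; elim: (index_enum G) (mem_index_enum x) => // y s IHs.
rewrite inE big_cons => /orP[/eqP <-|/IHs]; first exact: geq_minl.
by apply: leq_trans; apply: geq_minr.
Qed.

Lemma min_degree_ge (G : sgraph) d :
  d <= #|G| -> (forall x : G, d <= degree x) -> d <= min_degree G.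
Proof.
move=> dG dx; rewrite /min_degree; elim/big_ind: _ => // x y hx hy.
by rewrite leq_min hx.
Qed.

Lemma K4_free_of_contains (G : sgraph) : ~ contains_K 4 G -> K4_free (@adj G).
Proof.
move=> noK x y z w xy xz xw yz yw zw; apply: noK.
have ne u v : adj u v -> (u == v :> G) = false.
  by apply: contraTF => /eqP->; rewrite adj_irrefl.
exists [set x; y; z; w]; split=> [|u v].
  rewrite -!setUA !cardsU1 cards1 !inE.
  by rewrite (ne _ _ xy) (ne _ _ xz) (ne _ _ xw) (ne _ _ yz)
     (ne _ _ yw) (ne _ _ zw).
rewrite !inE -!orbA => /or4P[] /eqP-> /or4P[] /eqP->;
  by rewrite ?eqxx // ?xy ?xz ?xw ?yz ?yw ?zw //
    adj_sym ?xy ?xz ?xw ?yz ?yw ?zw.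
Qed.

Lemma chromatic_number_le (G : sgraph) k :
  colorable G k -> chromatic_number G <= k.
Proof. by rewrite /chromatic_number; case: ex_minnP => m _; apply. Qed.

Lemma colorable_no_clique (G : sgraph) k s :
  chromatic_number G <= k -> k < s -> ~ contains_K s G.
Proof.
rewrite /chromatic_number; case: ex_minnP => m /existsP[c /forallP cP] _ mk ks.
case=> S [cS SK].
have inj : {in S &, injective c}.
  move=> x y xS yS cxy; apply/eqP; apply: contraT => nxy.
  have := forallP (cP x) y; rewrite (SK x y xS yS nxy) /=.
  by rewrite cxy eqxx.
have := card_in_imset inj; have := max_card (c @: S).
rewrite card_ord cS; lia.
Qed.

Lemma f_lt n d : d <= 6 * n -> 0 < n ->
  7 * (6 * n - d) < 12 * n \/
    (exists q, [/\ 0 < q, n = 7 * q + 4 & 6 * n - d = 12 * q + 7]) ->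
  f n 7 4 < d.
Proof.
move=> d6 n0 hd.
have d0 : 0 < d by case: hd => [|[q []]]; lia.
rewrite -(prednK d0) ltnS.
apply/bigmax_leqP => d' /boolp.asboolP[G [bG noK <-]].
rewrite -ltnS (prednK d0) ltnNge; apply/negP => le_d.
have [part [cp ap]] := bG; have cG := card_balanced bG.
apply: (@K4_free_min_degree_absurd G (@adj G) n (6 * n - d) part) => //.
- exact: adj_sym.
- move=> x; have := card_nbrs (@adj G) x; have := min_degree_le x.
  rewrite cG -[degree x]/#|nbrs _ x|; lia.
- exact: adj_irrefl.
- exact: K4_free_of_contains.
Qed.

(** * The extremal 3-colourable graphs *)

Section Construction.
Variables n q p : nat.

(** The number of vertices of part [i] that get the third colour [ord_max]. The
    rest of parts 1, 2, 3 gets the first colour and the rest of parts 4, 5, 6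
    the second one; part 0 has no rest. Two values q <= p are needed for
    rounding: q is about n/7, and p is q or q + 1. *)
Definition threshold (i : 'I_7) := nth 0 [:: n; q; p; p; q; p; p] i.

Definition colour (u : 'I_7 * 'I_n) : 'I_3 :=
  if u.2 < threshold u.1 then ord_max
  else if u.1 <= 3 then ord0 else lift ord0 ord0.

Definition construction_adj (u v : 'I_7 * 'I_n) :=
  (u.1 != v.1) && (colour u != colour v).

Lemma construction_adj_sym : symmetric construction_adj.
Proof.
by move=> u v; rewrite /construction_adj eq_sym [colour u == _]eq_sym.
Qed.

Lemma construction_adj_irr : irreflexive construction_adj.
Proof. by move=> u; rewrite /construction_adj eqxx. Qed.

Definition construction := SGraph construction_adj_sym construction_adj_irr.

Lemma construction_balanced : balanced_multipartite n 7 construction.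
Proof.
exists (fun u : 'I_7 * 'I_n => u.1); split=> [i|u v /andP[]//].
rewrite -[RHS](card_ord n) -(card_imset _ (f := fun k : 'I_n => (i, k))).
  apply: eq_card => -[j k]; rewrite !inE /=.
  apply/eqP/imsetP => [->|[l _ []]//].
  by exists k.
by move=> k l [].
Qed.

Lemma construction_chromatic : chromatic_number construction <= 3.
Proof.
apply: chromatic_number_le; apply/existsP; exists (finfun colour).
by do 2!apply/forallP => ?; apply/implyP => /andP[_]; rewrite !ffunE.
Qed.

Hypotheses (qn : q <= n) (pn : p <= n).

Lemma threshold_le i : threshold i <= n.
Proof. by case: i => -[|[|[|[|[|[|[|i]]]]]]]. Qed.

Lemma card_ord_ltn t : t <= n -> #|[set l : 'I_n | l < t]| = t.
Proof.
move=> tn; rewrite -sum1_card; under eq_bigl do rewrite inE.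
by rewrite -(big_ord_widen n (fun=> 1)) // sum1_card card_ord.
Qed.

Definition base (j : 'I_7) : 'I_3 := if j <= 3 then ord0 else lift ord0 ord0.

Definition nbrs_in_part (u : 'I_7 * 'I_n) (j : 'I_7) :=
  if u.1 == j then 0 else
  if colour u == ord_max then n - threshold j else
  if colour u == base j then threshold j else n.

Lemma card_nbrs_in_part u j :
  #|slice (fun v => v.1) (nbrs construction_adj u) j| = nbrs_in_part u j.
Proof.
have -> : slice (fun v => v.1) (nbrs construction_adj u) j
    = (fun l : 'I_n => (j, l)) @: [set l | construction_adj u (j, l)].
  apply/setP => -[j' l]; rewrite !inE /=; apply/andP/imsetP => [[h /eqP jE]|].
    by subst j'; exists l; rewrite ?inE.
  by case=> l'; rewrite inE => h [-> ->].
rewrite card_imset => [|k l []//]; rewrite /nbrs_in_part /construction_adj /=.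
case: (eqVneq u.1 j) => [_|_] /=.
  by apply/eqP; rewrite cards_eq0; apply/eqP/setP => l; rewrite !inE.
have colE l : colour (j, l) = if l < threshold j then ord_max else base j by [].
have nmax : base j != ord_max by rewrite /base; case: ifP.
case: (eqVneq (colour u) ord_max) => [->|ncu].
  rewrite -[n in n - _]card_ord -(cardsC [set l : 'I_n | l < threshold j]).
  rewrite card_ord_ltn ?threshold_le // addKn; apply: eq_card => l.
  by rewrite !inE colE; case: ifP; rewrite ?eqxx // eq_sym.
case: (eqVneq (colour u) (base j)) => [cu|ncb].
  rewrite -[RHS](card_ord_ltn (threshold_le j)); apply: eq_card => l.
  by rewrite !inE colE; case: ifP; rewrite ?ncu // cu eqxx.
rewrite -[RHS]card_ord; apply: eq_card => l.
by rewrite !inE colE; case: ifP; rewrite ?ncu ?ncb.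
Qed.

Variable D : nat.
Hypotheses (qp : q <= p) (D1 : 2 * n <= D + q + p)
  (D2 : n + 2 * q + 3 * p <= D) (D3 : 0 < q -> n + q + 4 * p <= D).

(** A vertex misses its own part and the rest of its colour class. The three
    conditions bound that rest by D for the first and second colours, for the
    third colour in the parts that have p vertices of it (and in part 0), and
    for the third colour in the parts that have q of it, if there are any. *)
Lemma degree_construction (u : construction) : 6 * n <= degree u + D.
Proof.
have -> : degree u = \sum_j nbrs_in_part u j.
  rewrite -[degree u]/#|nbrs construction_adj u|.
  rewrite (card_sum_slices (fun v : 'I_7 * 'I_n => v.1)).
  by apply: eq_bigr => j _; rewrite card_nbrs_in_part.
rewrite !big_ord_recl big_ord0 /nbrs_in_part.
case: u => i k; have tk := ltn_ord k; have [kt|kt] := ltnP k (threshold i).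
  have -> : colour (i, k) = ord_max by rewrite /colour /= kt.
  by case: i kt => -[|[|[|[|[|[|[|i]]]]]]] //= ?; rewrite /threshold /=; lia.
have -> : colour (i, k) = base i by rewrite /colour /= ltnNge kt.
by case: i kt => -[|[|[|[|[|[|[|i]]]]]]] //= ?; rewrite /threshold /=; lia.
Qed.

End Construction.
(** * The values of f and delta *)

Lemma delta_ge n q p D d : q <= p -> p <= n ->
  2 * n <= D + q + p -> n + 2 * q + 3 * p <= D ->
  (0 < q -> n + q + 4 * p <= D) -> d + D <= 6 * n -> d <= delta n 7 3.
Proof.
move=> qp pn D1 D2 D3 dD.
have bG := construction_balanced n q p.
apply: leq_trans (max_min_degree_ub bG (construction_chromatic n q p)).
apply: min_degree_ge => [|u]; first by rewrite (card_balanced bG); lia.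
have := degree_construction (leq_trans qp pn) pn qp D1 D2 D3 u; lia.
Qed.

Lemma delta_le_f n : delta n 7 3 <= f n 7 4.
Proof.
apply/bigmax_leqP => d /boolp.asboolP[G [bG chiG <-]].
exact: max_min_degree_ub bG (colorable_no_clique chiG (ltnSn 3)).
Qed.

(** The graphs above with q = n / 7 attain the bound. For the residues 5 and 6
    rounding requires p = q + 1. So does n = 4: there q = 0 makes the condition
    on parts with q vertices of the third colour void, which is why the integer
    part of 30n/7 is reached for this n alone in its residue class. *)
Lemma extremal_value n : 1 <= n ->
  let v := if (n %% 7 == 4) && (11 <= n) then (30 * n) %/ 7 - 1
           else (30 * n) %/ 7 in
  f n 7 4 < v.+1 /\ v <= delta n 7 3.
Proof.
move=> n1 v; have vE : v = if (n %% 7 == 4) && (11 <= n) then (30 * n) %/ 7 - 1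
                            else (30 * n) %/ 7 by [].
have nE := divn_eq n 7; have r7 : n %% 7 < 7 by rewrite ltn_mod.
set q := n %/ 7 in nE; set r := n %% 7 in vE nE r7.
split.
  apply: f_lt => //; first by move: vE; case: ifP; lia.
  move: vE; case: ifP => [/andP[/eqP r4 n11]|_] vE; last by left; lia.
  by right; exists q; split; lia.
apply: (@delta_ge n q (q + (4 < r) + (n == 4)) (6 * n - v)).
all: move: vE; case: ifP; lia.
Qed.

Theorem theorem1p1 :
  (forall n : nat, 1 <= n ->
     f n 7 4 = if (n %% 7 == 4) && (11 <= n) then (30 * n) %/ 7 - 1
               else (30 * n) %/ 7) /\
  (forall n : nat, 1 <= n -> f n 7 4 = delta n 7 3).
Proof.
split=> n n1; have [up low] := extremal_value n1; have le := delta_le_f n.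
  by apply/eqP; rewrite eqn_leq (leq_trans low le) -ltnS up.
by apply/eqP; rewrite eqn_leq le (leq_trans _ low) // -ltnS.
Qed.
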